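(* Let $H$ be a Hilbert space and let $\{\phi_n\}_{n=0}^{\infty}$ be a frame on $H$ with constants $A,B>0$, i.e. $A\|x\|_H^2\leq \sum_{n=0}^{\infty}|\langle x,\phi_n\rangle|^2\leq B\|x\|_H^2$ for all $x\in H$. Then for every subspace $Y$ of $H$ that is a Banach space under a norm $\|\cdot\|_Y$ and is compactly embedded into $H$, there exists a sequence $(\varepsilon_n)_{n\geq 0}$ of nonnegative real numbers with $\varepsilon_n\searrow 0$ such that $|\langle y,\phi_n\rangle|\leq \varepsilon_n\|y\|_Y$ for every integer $n\geq 0$ and every $y\in Y$.
   Context: $\langle\cdot,\cdot\rangle$ is the inner product of $H$, linear in the first variable. A Banach space $(Y,\|\cdot\|_Y)$ is compactly embedded into $H$ if $Y$ is a linear subspace of $H$ and the inclusion map $(Y,\|\cdot\|_Y)\to (H,\|\cdot\|_H)$ is a compact operator, i.e. the unit ball $\{y\in Y:\|y\|_Y\leq 1\}$ is relatively compact in $H$. The norm $\|\cdot\|_Y$ is in general not the restriction of $\|\cdot\|_H$. The notation $\varepsilon_n\searrow 0$ means that $(\varepsilon_n)$ is nonincreasing and converges to $0$. *)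

(* Defs.v *)
From HB Require Import structures.
From mathcomp Require Import all_boot all_order all_algebra.
From mathcomp Require Import complex.
From mathcomp Require Import all_classical all_reals all_analysis.

Set Implicit Arguments.
Unset Strict Implicit.
Unset Printing Implicit Defensive.

Import Order.TTheory GRing.Theory Num.Theory.
Import numFieldNormedType.Exports.
Local Open Scope classical_set_scope.
Local Open Scope ring_scope.

(* Hilbert and Banach spaces are taken over R or over R[i]; the theorem
   quantifies over this choice. *)
Variant scalar_kind := RealScalars | ComplexScalars.

Definition scalars (R : realType) (k : scalar_kind) : numFieldType :=
  match k with
  | RealScalars => R
  | ComplexScalars => R[i]
  end.

Definition conj_scalar (R : realType) (k : scalar_kind) :
    scalars R k -> scalars R k :=
  match k return scalars R k -> scalars R k with
  | RealScalars => idfun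
  | ComplexScalars => @Num.conj R[i]
  end.

Definition re_scalar (R : realType) (k : scalar_kind) : scalars R k -> R :=
  match k return scalars R k -> R with
  | RealScalars => idfun
  | ComplexScalars => @complex.Re R
  end.

(* MathComp norms are valued in the scalar field: over R[i], `|x| is a complex
   number with zero imaginary part. rnorm x is the same number, in R. *)
Definition rnorm (R : realType) (k : scalar_kind)
    (V : normedZmodType (scalars R k)) (x : V) : R := re_scalar `|x|.

(* The sum is taken in the extended reals, so the upper bound includes the
   convergence of the series. *)
Definition is_frame (R : realType) (k : scalar_kind)
    (H : normedModType (scalars R k)) (dot : H -> H -> scalars R k)
    (phi : nat -> H) (A B : R) : Prop :=
  [/\ 0 < A, 0 < B & forall x : H,
    let S := (\sum_(0 <= n <oo) (rnorm (dot x (phi n)) ^+ 2)%:E)%E in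
    ((A * rnorm x ^+ 2)%:E <= S)%E /\ (S <= (B * rnorm x ^+ 2)%:E)%E].

(* A linear subspace U = {x : V | S x} of V, with inclusion \val : U -> V, that
   is a Banach space under a norm of its own. That norm and its topology are
   unrelated to any norm on V, of which only the module structure is used. *)
#[short(type="subBanachType")]
HB.structure Definition SubBanach (K : numFieldType) (V : lmodType K)
    (S : pred V) :=
  {U of @GRing.SubLmodule K V S U & @CompleteNormedModule K U}.

Definition compactly_embedded (K : numFieldType) (H : normedModType K)
    (S : pred H) (Y : subBanachType S) : Prop :=
  precompact ((\val : Y -> H) @` [set y : Y | `|y| <= 1]).

(* Main.v *)
Require Import Defs.
From mathcomp Require Import all_boot all_order all_algebra.
From mathcomp Require Import complex.
From mathcomp Require Import all_classical all_reals all_analysis.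

Set Implicit Arguments.
Unset Strict Implicit.
Unset Printing Implicit Defensive.

Import Order.TTheory GRing.Theory Num.Theory.
Import numFieldNormedType.Exports.
Local Open Scope classical_set_scope.
Local Open Scope ring_scope.

(** A partial sum of the |<x, phi_n>|^2 is at most B |x|^2. Keeping a single term
    gives [rnorm_dot_le], |<x, phi_n>| <= sqrt B |x|, so that the functionals
    <., phi_n> are Lipschitz with one common constant. Keeping all of them gives
    [cvg_rnorm_dot], <x, phi_n> --> 0 for each fixed x, because the terms of a
    convergent series tend to 0. On a compact set an equi-Lipschitz family that
    tends to 0 pointwise tends to 0 uniformly ([equiLipschitz_cvg0_compact]).
    The closure in H of the unit ball of Y is such a compact set. Hence

      eps_n = sup { |<y, phi_m>| : m >= n, |y|_Y <= 1 }

    is finite and decreases to 0, and rescaling y to norm 1 in Y gives the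
    inequality for every y in Y. *)

(** * Real-valued norms *)

Section RealNorm.
Context (R : realType) (k : scalar_kind).
Implicit Type V : normedZmodType (scalars R k).

Lemma re_scalarD (a b : scalars R k) :
  re_scalar (a + b) = re_scalar a + re_scalar b.
Proof. by case: k a b => //= - [a1 a2] [b1 b2]. Qed.

Lemma re_scalar0 : re_scalar (0 : scalars R k) = 0.
Proof. by case: k. Qed.

Lemma le_re_scalar (a b : scalars R k) :
  a <= b -> re_scalar a <= re_scalar b.
Proof. by case: k a b => //= a b; rewrite lecE => /andP[]. Qed.

Lemma re_scalar1 : re_scalar (1 : scalars R k) = 1.
Proof. by case: k. Qed.

(** Over R[i] the term - Im a * Im b of the real part vanishes because a
    nonnegative complex number is real. *)
Lemma re_scalarM (a b : scalars R k) : 0 <= a ->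
  re_scalar (a * b) = re_scalar a * re_scalar b.
Proof.
case: k a b => //= - [a1 a2] [b1 b2]; rewrite lecE /= => /andP[/eqP -> _].
by rewrite mul0r subr0.
Qed.

Lemma rnorm_ge0 V (x : V) : 0 <= rnorm x.
Proof. by rewrite /rnorm -re_scalar0 le_re_scalar. Qed.

Lemma ler_rnormD V (x y : V) : rnorm (x + y) <= rnorm x + rnorm y.
Proof. by rewrite /rnorm -re_scalarD le_re_scalar// ler_normD. Qed.

Lemma rnorm0 V : rnorm (0 : V) = 0.
Proof. by rewrite /rnorm normr0 re_scalar0. Qed.

Lemma rnormM (a b : scalars R k) : rnorm (a * b) = rnorm a * rnorm b.
Proof. by rewrite /rnorm normrM re_scalarM. Qed.

Lemma rnorm_norm V (x : V) : rnorm `|x| = rnorm x.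
Proof. by rewrite /rnorm normr_id. Qed.

(** Over R[i] the radius of a ball is a complex number, whereas all estimates
    below are in R: this lemma passes from one to the other. *)
Lemma near_rnorm_lt (V : normedModType (scalars R k)) (x : V) (e : R) :
  0 < e -> \forall y \near x, rnorm (y - x) < e.
Proof.
move=> e0.
have [d d0 de] : exists2 d : scalars R k, 0 < d &
    forall a, a < d -> re_scalar a < e.
  case: k => /=; first by exists e.
  exists (e%:C)%C; first by rewrite ltcR.
  by move=> [a1 a2]; rewrite ltcE /= => /andP[].
by apply/nbhs_normP; exists d => //= y; rewrite /= distrC => /de.
Qed.

End RealNorm.

(** * Uniform convergence on compact sets *)

Lemma compact_rnorm_bounded (R : realType) (k : scalar_kind)
    (V : normedModType (scalars R k)) (K : set V) :
  compact K -> exists C : R, forall x, K x -> rnorm x <= C.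
Proof.
move=> /compact_near_coveringP cK.
have : \forall n \near \oo, K `<=` (fun x => rnorm x <= n%:R).
  apply: cK => x Kx; near=> y n => /=.
  rewrite -(subrK x y) (le_trans (ler_rnormD _ _))//.
  rewrite (@le_trans _ _ (1 + rnorm x))// ?lerD2r.
    by near: y; have := near_rnorm_lt x (@ltr01 R); apply: filterS => y /ltW.
  by near: n; exact: nbhs_infty_ger.
by move=> [N _ /(_ N (leqnn N)) KN]; exists N%:R.
Unshelve. all: by end_near. Qed.

(** Around each point of K, the values are controlled by those at the point
    once n is large; compactness makes one n work for all of K. *)
Lemma equiLipschitz_cvg0_compact (R : realType) (k : scalar_kind)
    (V : normedModType (scalars R k)) (K : set V) (f : nat -> V -> R) (C : R) :
  0 < C -> (forall n x y, f n y <= f n x + C * rnorm (y - x)) ->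
  (forall x, f ^~ x @ \oo --> (0 : R)) -> compact K ->
  forall e, 0 < e -> \forall n \near \oo, forall x, K x -> f n x <= e.
Proof.
move=> C0 fC f0 /compact_near_coveringP cK e e0.
apply: (cK _ _ (fun n x => f n x <= e)) => x Kx; near=> y n => /=.
rewrite (le_trans (fC n x y))// (splitr e) lerD//.
  near: n; have e20 : 0 < e / 2 by rewrite divr_gt0.
  have /cvgrPdist_le/(_ _ e20) := f0 x; apply: filterS => n.
  by rewrite sub0r normrN; exact/le_trans/ler_norm.
rewrite mulrC -ler_pdivlMr//; apply/ltW; near: y.
by apply: near_rnorm_lt; rewrite !divr_gt0.
Unshelve. all: by end_near. Qed.

(** * Frame coefficients *)

Section FrameCoefficients.
Context (R : realType) (k : scalar_kind) (H : normedModType (scalars R k)).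
Variables (dot : {dot H for @conj_scalar R k}) (phi : nat -> H) (A B : R).
Hypothesis frame_phi : is_frame dot phi A B.

Lemma frame_partial_sum_le (x : H) (n : nat) :
  \sum_(0 <= i < n) rnorm (dot x (phi i)) ^+ 2 <= B * rnorm x ^+ 2.
Proof.
have [_ _ /(_ x)[_ leB]] := frame_phi.
rewrite -lee_fin -sumEFin (le_trans _ leB)//.
by apply: nneseries_lim_ge => i _ _; rewrite lee_fin sqr_ge0.
Qed.

Lemma rnorm_dot_le (x : H) (n : nat) :
  rnorm (dot x (phi n)) <= Num.sqrt B * rnorm x.
Proof.
have [_ B0 _] := frame_phi.
rewrite -ler_sqr ?nnegrE ?mulr_ge0 ?sqrtr_ge0 ?rnorm_ge0//.
rewrite exprMn sqr_sqrtr ?(ltW B0)//.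
apply: le_trans (frame_partial_sum_le x n.+1).
by rewrite big_nat_recr//= lerDr sumr_ge0// => i _; rewrite sqr_ge0.
Qed.

Lemma cvg_rnorm_dot (x : H) :
  rnorm (dot x (phi n)) @[n --> \oo] --> (0 : R).
Proof.
have : (rnorm (dot x (phi n)) ^+ 2) @[n --> \oo] --> (0 : R).
  apply: cvg_series_cvg_0; apply: nondecreasing_is_cvgn.
    by apply: nondecreasing_series => n _ _; rewrite sqr_ge0.
  exists (B * rnorm x ^+ 2) => _ [n _ <-]; exact: frame_partial_sum_le.
move=> sq0; apply/cvgrPdist_le => e e0.
have /cvgrPdist_le/(_ (e ^+ 2)) := sq0; rewrite exprn_gt0// => /(_ isT).
apply: filterS => n; rewrite !sub0r !normrN normrX.
by rewrite ler_sqr ?nnegrE ?(ltW e0).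
Qed.

Lemma rnorm_dot_lipschitz (n : nat) (x y : H) :
  rnorm (dot y (phi n)) <= rnorm (dot x (phi n)) + Num.sqrt B * rnorm (y - x).
Proof.
rewrite -{1}(subrK x y) linearDl addrC (le_trans (ler_rnormD _ _))//.
by rewrite lerD2l rnorm_dot_le.
Qed.

End FrameCoefficients.

Theorem corollary2p4 (R : realType) (k : scalar_kind)
    (H : completeNormedModType (scalars R k))
    (dot : {dot H for @conj_scalar R k})
    (dot_norm : forall x : H, dot x x = `|x| ^+ 2)
    (phi : nat -> H) (A B : R) (frame_phi : is_frame dot phi A B)
    (S : pred H) (Y : subBanachType S) (compactY : compactly_embedded Y) :
  exists eps : nat -> R,
    [/\ forall n, 0 <= eps n,
        nonincreasing_seq eps,
        eps @ \oo --> (0 : R) &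
        forall (n : nat) (y : Y),
          rnorm (dot (\val y) (phi n)) <= eps n * rnorm y].
Proof.
pose c n (x : H) : R := rnorm (dot x (phi n)).
pose K := closure ((\val : Y -> H) @` [set y : Y | `|y| <= 1]).
have cK : compact K by rewrite /K -precompactE.
have ballK (y : Y) : `|y| <= 1 -> K (\val y).
  by move=> y1; apply: subset_closure; exists y.
pose E n : set R :=
  [set r | exists m (y : Y), [/\ (n <= m)%N, `|y| <= 1 & r = c m (\val y)]].
have sqrtB_gt0 : 0 < Num.sqrt B by have [_ B0 _] := frame_phi; rewrite sqrtr_gt0.
have [M KM] := compact_rnorm_bounded cK.
have E0 n : E n 0.
  by exists n, 0; split; rewrite ?normr0 ?ler01// /c raddf0 linear0l rnorm0.
have E_sup n : has_sup (E n).
  split; first by exists 0.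
  exists (Num.sqrt B * M) => _ [m [y [_ y1 ->]]].
  rewrite (le_trans (rnorm_dot_le frame_phi _ _))// ler_pM2l//.
  by apply: KM; exact: ballK.
have le_supE n m (y : Y) : (n <= m)%N -> `|y| <= 1 -> c m (\val y) <= sup (E n).
  by move=> nm y1; apply: sup_upper_bound => //; exists m, y.
exists (fun n => sup (E n)); split.
- by move=> n; apply: sup_upper_bound.
- move=> n m nm; apply: ge_sup; first by exists 0.
  by move=> _ [p [y [mp y1 ->]]]; apply: le_supE => //; exact: leq_trans mp.
- apply/cvgrPdist_le => e e0.
  have [N _ cN] := equiLipschitz_cvg0_compact sqrtB_gt0
    (rnorm_dot_lipschitz frame_phi) (cvg_rnorm_dot frame_phi) cK e0.
  exists N => // n /= Nn.
  rewrite sub0r normrN ger0_norm; last exact: sup_upper_bound.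
  apply: ge_sup; first by exists 0.
  move=> _ [m [y [nm y1 ->]]]; apply: cN; last exact: ballK.
  exact: leq_trans nm.
- move=> n y; have [->|y0] := eqVneq y 0.
    by rewrite raddf0 linear0l !rnorm0 mulr0.
  have ny0 : `|y| != 0 by rewrite normr_eq0.
  pose z : Y := `|y|^-1 *: y.
  have z1 : `|z| <= 1 by rewrite /z normrZ normfV normr_id mulVf.
  have yz : y = `|y| *: z by rewrite /z scalerA mulfV// scale1r.
  rewrite {1}yz linearZ linearZl_LR /= rnormM rnorm_norm mulrC.
  by rewrite ler_wpM2r ?rnorm_ge0//; exact: le_supE.
Qed.
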